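(* Let $x:I\subset\mathbb{R}\to\mathbb{E}^3$ be a unit speed twisted curve in $\mathbb{E}^3$ with curvatures $\kappa_1>0$ and $\kappa_2\neq0$. Then $x$ is a $T$-constant curve of first kind if and only if $$\frac{\kappa_2}{\kappa_1}-\left(\frac{\kappa_1'}{\kappa_1^2\kappa_2}\right)'=0.$$
   Context: For a unit speed curve $x(s)$ in Euclidean 3-space $\mathbb{E}^3$, the Frenet frame $T=x'$, $N_1$, $N_2=T\times N_1$ and curvature $\kappa_1=\|x''\|$, torsion $\kappa_2$ satisfy $T'=\kappa_1N_1$, $N_1'=-\kappa_1T+\kappa_2N_2$, $N_2'=-\kappa_2N_1$; primes denote derivatives in arclength $s$. A curve is twisted if $\kappa_1$ and $\kappa_2$ are nowhere zero. The position vector decomposes as $x=x^T+x^N$ into its components tangential and normal to the curve. The curve is $T$-constant if $\|x^T\|$ is constant; it is $T$-constant of first kind if $\|x^T\|=0$, and of second kind otherwise.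
   Formalization: ''x is T-constant of first kind'' is read as: for some choice of origin o, x − o is T-constant of first kind; with a fixed origin the ''if'' part fails, since translating a twisted spherical curve keeps the equation but destroys x^T = 0. *)

(* Defs.v *)
From HB Require Import structures.
From mathcomp Require Import all_boot all_order all_algebra.
From mathcomp Require Import all_classical all_reals all_analysis.

Set Implicit Arguments.
Unset Strict Implicit.
Unset Printing Implicit Defensive.

Import Order.TTheory GRing.Theory Num.Theory.
Import numFieldNormedType.Exports.

Local Open Scope classical_set_scope.
Local Open Scope ring_scope.

(* Euclidean 3-space is 'rV[R]_3.  The library's norm `|u| on row vectors is
   the sup norm, so the Euclidean norm is [enorm]; both induce the same
   topology, hence the same derivatives. *)

Definition dot (R : realType) (u v : 'rV[R]_3) : R :=
  \sum_(i < 3) u ord0 i * v ord0 i.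

Definition enorm (R : realType) (u : 'rV[R]_3) : R := Num.sqrt (dot u u).

(* The sums i + 1 and i + 2 are taken in 'I_3, i.e. modulo 3:
   (u x v)_i = u_(i+1) v_(i+2) - u_(i+2) v_(i+1). *)
Definition cross (R : realType) (u v : 'rV[R]_3) : 'rV[R]_3 :=
  \row_(i < 3) (u ord0 (i + 1) * v ord0 (i + 2%:R)
                - u ord0 (i + 2%:R) * v ord0 (i + 1)).

(* Curves are total functions R -> 'rV[R]_3 of which only the restriction to
   an open interval I matters; as I is open, derivatives at points of I only
   depend on that restriction. *)

Definition differentiable_times (R : realType) (n : nat) (I : set R)
    (x : R -> 'rV[R]_3) : Prop :=
  forall k, (k < n)%N -> forall s, I s -> derivable (derive1n k x) s 1.

Definition tangent (R : realType) (x : R -> 'rV[R]_3) : R -> 'rV[R]_3 :=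
  derive1 x.

Definition unit_speed (R : realType) (I : set R) (x : R -> 'rV[R]_3) : Prop :=
  forall s, I s -> enorm (tangent x s) = 1.

Definition curvature (R : realType) (x : R -> 'rV[R]_3) (s : R) : R :=
  enorm (derive1n 2 x s).

Definition normal1 (R : realType) (x : R -> 'rV[R]_3) (s : R) : 'rV[R]_3 :=
  (curvature x s)^-1 *: derive1n 2 x s.

Definition normal2 (R : realType) (x : R -> 'rV[R]_3) (s : R) : 'rV[R]_3 :=
  cross (tangent x s) (normal1 x s).

(* The N2-component of N1' = - kappa1 T + kappa2 N2. *)
Definition torsion (R : realType) (x : R -> 'rV[R]_3) (s : R) : R :=
  dot (derive1 (normal1 x) s) (normal2 x s).

(* Orthogonal projection of the position vector on the tangent line; the
   tangent is a unit vector. *)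
Definition tangential_part (R : realType) (x : R -> 'rV[R]_3) (s : R) :
    'rV[R]_3 :=
  dot (x s) (tangent x s) *: tangent x s.

Definition T_constant (R : realType) (I : set R) (x : R -> 'rV[R]_3) : Prop :=
  exists c : R, forall s, I s -> enorm (tangential_part x s) = c.

Definition T_constant_first_kind (R : realType) (I : set R)
    (x : R -> 'rV[R]_3) : Prop :=
  T_constant I x /\ forall s, I s -> enorm (tangential_part x s) = 0.

(* The position vector of x with respect to the origin o.  Being T-constant
   depends on o, whereas curvature and torsion do not. *)
Definition position_from (R : realType) (o : 'rV[R]_3) (x : R -> 'rV[R]_3) :
    R -> 'rV[R]_3 :=
  fun s => x s - o.

(* Main.v *)
Require Import Defs.
From HB Require Import structures.
From mathcomp Require Import all_boot all_order all_algebra.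
From mathcomp Require Import all_classical all_reals all_analysis.
From mathcomp Require Import ring.

Set Implicit Arguments.
Unset Strict Implicit.
Unset Printing Implicit Defensive.

Import Order.TTheory GRing.Theory Num.Theory.
Import numFieldNormedType.Exports.

Local Open Scope classical_set_scope.
Local Open Scope ring_scope.

(** Being T-constant of first kind with respect to an origin o means that
    y = x - o is orthogonal to T on I, because the length of the tangential part
    is the absolute value of dot y T.

    Suppose dot y T = 0.  Differentiating this with y' = T and the Frenet
    equations gives 1 + kappa1 (dot y N1) = 0, that is dot y N1 = - 1 / kappa1;
    differentiating again gives dot y N2 = kappa1' / (kappa1^2 kappa2), the
    quantity called [focal_coef] below; a third differentiation gives
    focal_coef' = - kappa2 (dot y N1) = kappa2 / kappa1, which is the equation
    ([is_derive_focal_coef]).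

    Conversely, the two coordinates just found tell where the origin has to be:
    at x + (1 / kappa1) N1 - focal_coef N2, the center of the osculating sphere.
    By the Frenet equations the derivative of this point is
    (kappa2 / kappa1 - focal_coef') N2, so the equation makes it constant on the
    interval, and x minus this constant has no component along T
    ([exists_focal_center]).  Thus the condition also says that x lies on a
    sphere about o.

    Both computations are carried out for an abstract frame satisfying the
    Frenet equations ([frenet_curve]).  [unit_speed_frenet] shows that the frame
    built from the derivatives of a unit speed curve is one, and
    [derivable_focal_coef] is where the fourth derivative of x is consumed: for
    a function that is not derivable, the value of [derive1] would carry no
    information. *)

(** * Scalar and vector products in dimension 3 *)

Lemma dotE (R : realType) (u v : 'rV[R]_3) :
  dot u v = u ord0 0 * v ord0 0 + u ord0 1 * v ord0 1
            + u ord0 2%:R * v ord0 2%:R.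
Proof.
rewrite /dot !big_ord_recl big_ord0 addr0 addrA.
by congr (_ * _ + _ * _ + _ * _); congr (_ _ _); apply/val_inj.
Qed.

Lemma row3P (R : realType) (u v : 'rV[R]_3) :
  u ord0 0 = v ord0 0 -> u ord0 1 = v ord0 1 -> u ord0 2%:R = v ord0 2%:R ->
  u = v.
Proof.
move=> h0 h1 h2; apply/rowP => -[[|[|[|//]]] lti].
- by move: h0; congr (u _ _ = v _ _); apply/val_inj.
- by move: h1; congr (u _ _ = v _ _); apply/val_inj.
- by move: h2; congr (u _ _ = v _ _); apply/val_inj.
Qed.

Lemma crossE (R : realType) (u v : 'rV[R]_3) :
  [/\ cross u v ord0 0 = u ord0 1 * v ord0 2%:R - u ord0 2%:R * v ord0 1,
      cross u v ord0 1 = u ord0 2%:R * v ord0 0 - u ord0 0 * v ord0 2%:R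
    & cross u v ord0 2%:R = u ord0 0 * v ord0 1 - u ord0 1 * v ord0 0].
Proof.
by split; rewrite mxE; congr (_ * _ - _ * _); congr (_ _ _); apply/val_inj.
Qed.

(** The expansion of w in the basis u, v, u x v by Cramer's rule, cleared of
    its denominator, which makes it a polynomial identity valid without any
    independence hypothesis.  For orthonormal u and v the factor on the left
    is 1. *)
Lemma gram_decomposition (R : realType) (u v w : 'rV[R]_3) :
  (dot u u * dot v v - dot u v ^+ 2) *: w =
  (dot w u * dot v v - dot w v * dot u v) *: u
  + (dot w v * dot u u - dot w u * dot u v) *: v
  + dot w (cross u v) *: cross u v.
Proof.
case: (crossE u v); move: (cross u v) => p p0 p1 p2.
by apply: row3P; rewrite !mxE !dotE p0 p1 p2; ring.
Qed.

Lemma dotC (R : realType) (u v : 'rV[R]_3) : dot u v = dot v u.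
Proof. by rewrite !dotE; ring. Qed.

Lemma dotDl (R : realType) (u v w : 'rV[R]_3) :
  dot (u + v) w = dot u w + dot v w.
Proof. by rewrite !dotE !mxE; ring. Qed.

Lemma dotZl (R : realType) (a : R) (u v : 'rV[R]_3) :
  dot (a *: u) v = a * dot u v.
Proof. by rewrite !dotE !mxE; ring. Qed.

Lemma dotDr (R : realType) (u v w : 'rV[R]_3) :
  dot w (u + v) = dot w u + dot w v.
Proof. by rewrite dotC dotDl !(dotC _ w). Qed.

Lemma dotZr (R : realType) (a : R) (u v : 'rV[R]_3) :
  dot v (a *: u) = a * dot v u.
Proof. by rewrite dotC dotZl dotC. Qed.

Lemma dot_cross_l (R : realType) (u v : 'rV[R]_3) : dot u (cross u v) = 0.
Proof. by have [c0 c1 c2] := crossE u v; rewrite dotE c0 c1 c2; ring. Qed.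

Lemma crossZl (R : realType) (a : R) (u v : 'rV[R]_3) :
  cross (a *: u) v = a *: cross u v.
Proof. by apply/rowP => i; rewrite !mxE; ring. Qed.

Lemma crossZr (R : realType) (a : R) (u v : 'rV[R]_3) :
  cross v (a *: u) = a *: cross v u.
Proof. by apply/rowP => i; rewrite !mxE; ring. Qed.

Lemma crossDr (R : realType) (u v w : 'rV[R]_3) :
  cross w (u + v) = cross w u + cross w v.
Proof. by apply/rowP => i; rewrite !mxE; ring. Qed.

Lemma crossuu (R : realType) (u : 'rV[R]_3) : cross u u = 0.
Proof. by apply/rowP => i; rewrite !mxE; ring. Qed.

Lemma cross_cross (R : realType) (u v : 'rV[R]_3) :
  cross u (cross u v) = dot u v *: u - dot u u *: v.
Proof.
have [c0 c1 c2] := crossE u v.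
case: (crossE u (cross u v)); rewrite c0 c1 c2.
move: (cross u (cross u v)) => p p0 p1 p2.
by apply: row3P; rewrite !mxE ?p0 ?p1 ?p2 !dotE; ring.
Qed.

Lemma enorm_sqr (R : realType) (u : 'rV[R]_3) : enorm u ^+ 2 = dot u u.
Proof.
by rewrite sqr_sqrtr// /dot; apply: sumr_ge0 => i _; rewrite -expr2 sqr_ge0.
Qed.

(** * Derivatives of vector-valued functions *)

(** Reduces the product rules for vectors to the one for real functions. *)
Lemma is_derive_rowP (R : realType) (X : R -> 'rV[R]_3) (s : R)
    (dX : 'rV[R]_3) :
  is_derive s 1 X dX <->
  forall i, is_derive s 1 (fun t => X t ord0 i) (dX ord0 i).
Proof.
split=> [[Xs <-] i|Xs].
- rewrite derive_mx// mxE; apply: derivableP.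
  by move/derivable_mxP : Xs; apply.
- have dXs : derivable X s 1.
    by apply/derivable_mxP => i j; rewrite (ord1 i);
      apply: (@ex_derive _ _ _ _ _ _ _ (Xs j)).
  apply: DeriveDef => //; rewrite derive_mx//; apply/rowP => i.
  by rewrite mxE; apply: derive_val.
Qed.

Lemma is_derive_mul (R : realType) (f g : R -> R) (s df dg : R) :
  is_derive s 1 f df -> is_derive s 1 g dg ->
  is_derive s 1 (fun t => f t * g t) (df * g s + f s * dg).
Proof.
move=> fs gs; apply: (@is_derive_eq _ _ _ (f * g)).
by rewrite /GRing.scale/= addrC mulrC.
Qed.

Lemma is_derive_scale (R : realType) (f : R -> R) (X : R -> 'rV[R]_3) (s df : R)
    (dX : 'rV[R]_3) :
  is_derive s 1 f df -> is_derive s 1 X dX ->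
  is_derive s 1 (fun t => f t *: X t) (df *: X s + f s *: dX).
Proof.
move=> fs /is_derive_rowP Xs; apply/is_derive_rowP => i.
rewrite !mxE; under eq_fun do rewrite mxE.
exact: is_derive_mul.
Qed.

Lemma is_derive_dot (R : realType) (X Y : R -> 'rV[R]_3) (s : R)
    (dX dY : 'rV[R]_3) :
  is_derive s 1 X dX -> is_derive s 1 Y dY ->
  is_derive s 1 (fun t => dot (X t) (Y t)) (dot dX (Y s) + dot (X s) dY).
Proof.
move=> /is_derive_rowP Xs /is_derive_rowP Ys.
have XY i := is_derive_mul (Xs i) (Ys i).
rewrite /dot -big_split/=.
have := is_derive_sum (fun i => XY i).
by rewrite fct_sumE.
Qed.

Lemma is_derive_cross (R : realType) (X Y : R -> 'rV[R]_3) (s : R)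
    (dX dY : 'rV[R]_3) :
  is_derive s 1 X dX -> is_derive s 1 Y dY ->
  is_derive s 1 (fun t => cross (X t) (Y t)) (cross dX (Y s) + cross (X s) dY).
Proof.
move=> /is_derive_rowP Xs /is_derive_rowP Ys; apply/is_derive_rowP => i.
under eq_fun do rewrite mxE.
rewrite !mxE; apply: (is_derive_eq (is_deriveB (is_derive_mul (Xs _) (Ys _))
  (is_derive_mul (Xs _) (Ys _)))).
by ring.
Qed.

Lemma derive_eq0_cst_interval (R : realType) (I : set R) (X : R -> 'rV[R]_3) :
  is_interval I -> (forall s, I s -> is_derive s 1 X 0) ->
  forall s t, I s -> I t -> X s = X t.
Proof.
move=> itvI dX s t; wlog st : s t / s <= t.
  by move=> H Is It; have [/H->//|/ltW/H->//] := leP s t.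
move=> Is It; apply/rowP => i.
have dXi z : z \in `[s, t] -> is_derive z 1 (fun t => X t ord0 i) 0.
  rewrite in_itv/= => zst.
  have /is_derive_rowP/(_ i) := dX z (itvI _ _ Is It _ zst).
  by rewrite mxE.
have dXi_oo z : z \in `]s, t[ -> is_derive z 1 (fun t => X t ord0 i) 0.
  by move=> zst; apply: dXi; exact: subset_itv_oo_cc zst.
have cXi : {within `[s, t], continuous (fun t => X t ord0 i)}.
  apply: derivable_within_continuous => z zst.
  by apply: (@ex_derive _ _ _ _ _ _ _ (dXi z zst)).
have [z _] := MVT_segment st dXi_oo cXi.
by rewrite mul0r => /subr0_eq ->.
Qed.

(** * Derivatives of functions known on an open set only *)

(** An identity between functions may be differentiated as soon as it holds on
    an open set; this is the step by which each identity on I yields the next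
    one. *)
Lemma is_derive_eq_in_open (R : realType) (V : normedModType R) (I : set R)
    (f g : R -> V) (s : R) (df : V) :
  open I -> I s -> (forall t, I t -> f t = g t) ->
  is_derive s 1 f df -> is_derive s 1 g df.
Proof.
move=> openI Is fg; apply: near_eq_is_derive; near do apply: fg.
exact: open_nbhs_nbhs.
Unshelve. all: by end_near. Qed.

Lemma derivable_is_derive1 (R : realType) (V : normedModType R) (f : R -> V)
    (s : R) :
  derivable f s 1 -> is_derive s 1 f (derive1 f s).
Proof. by rewrite derive1E; exact: derivableP. Qed.

Lemma is_derive_derive1 (R : realType) (V : normedModType R) (f : R -> V)
    (s : R) (df : V) :
  is_derive s 1 f df -> derive1 f s = df.
Proof. by rewrite derive1E => ?; apply: derive_val. Qed.

Lemma is_derive_derive1_in_open (R : realType) (V : normedModType R) (I : set R)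
    (f g : R -> V) (s : R) (dg : V) :
  open I -> I s -> (forall t, I t -> is_derive t 1 f (g t)) ->
  is_derive s 1 g dg -> is_derive s 1 (derive1 f) dg.
Proof.
move=> openI Is df; apply: is_derive_eq_in_open openI Is _ => t It.
by rewrite (is_derive_derive1 (df t It)).
Qed.

Lemma is_derive_unique (R : realType) (V : normedModType R) (f : R -> V) (s : R)
    (df dg : V) :
  is_derive s 1 f df -> is_derive s 1 f dg -> df = dg.
Proof. by move=> /is_derive_derive1 <- /is_derive_derive1. Qed.

Lemma is_derive_derivable (R : realType) (V : normedModType R) (f : R -> V)
    (s : R) (df : V) :
  is_derive s 1 f df -> derivable f s 1.
Proof. by move=> ?; apply: ex_derive. Qed.

(** * Curves with a frame satisfying the Frenet equations *)

(** The frame is kept independent of x so that the arguments below see the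
    Frenet equations only, not the iterated derivatives and square roots that
    the frame is made of. *)
Record frenet_curve (R : realType) (I : set R) (x T N1 N2 : R -> 'rV[R]_3)
    (k tau : R -> R) : Prop := FrenetCurve {
  frenet_der : forall s, I s -> is_derive s 1 x (T s);
  frenet_T : forall s, I s -> is_derive s 1 T (k s *: N1 s);
  frenet_N1 : forall s, I s ->
    is_derive s 1 N1 (- k s *: T s + tau s *: N2 s);
  frenet_N2 : forall s, I s -> is_derive s 1 N2 (- tau s *: N1 s);
  frenet_TT : forall s, I s -> dot (T s) (T s) = 1;
  frenet_TN1 : forall s, I s -> dot (T s) (N1 s) = 0;
  frenet_TN2 : forall s, I s -> dot (T s) (N2 s) = 0;
  frenet_k : forall s, I s -> derivable k s 1;
  frenet_k_neq0 : forall s, I s -> k s != 0;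
  frenet_tau_neq0 : forall s, I s -> tau s != 0
}.

(** The binormal coordinate of x seen from the center of its osculating
    sphere. *)
Definition focal_coef (R : realType) (k tau : R -> R) (t : R) : R :=
  derive1 k t / (k t ^+ 2 * tau t).

(** Three differentiations of dot y T = 0 determine the coordinates of
    y = x - o on N1 and N2, and then relate them. *)
Lemma is_derive_focal_coef (R : realType) (I : set R)
    (x T N1 N2 : R -> 'rV[R]_3)
    (k tau : R -> R) (o : 'rV[R]_3) :
  open I -> frenet_curve I x T N1 N2 k tau ->
  (forall s, I s -> dot (x s - o) (T s) = 0) ->
  forall s, I s -> is_derive s 1 (focal_coef k tau) (tau s / k s).
Proof.
move=> openI F perp.
have dy s : I s -> is_derive s 1 (fun t => x t - o) (T s).
  move=> Is; have := is_deriveB (frenet_der F Is) (is_derive_cst o s 1).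
  by rewrite subr0.
have yN1 s : I s -> dot (x s - o) (N1 s) = - (k s)^-1.
  move=> Is.
  (* dot y T is constant, so 1 + k (dot y N1) = 0. *)
  have d0 : is_derive s 1 (fun t => dot (x t - o) (T t)) 0.
    apply: (is_derive_eq_in_open openI Is _ (is_derive_cst 0 s 1)) => t It.
    by rewrite perp.
  have := is_derive_unique (is_derive_dot (dy s Is) (frenet_T F Is)) d0.
  rewrite (frenet_TT F Is) dotZr => e.
  have k0 := frenet_k_neq0 F Is.
  by apply: (mulfI k0); rewrite mulrN divff//; apply/eqP;
    rewrite -addr_eq0 addrC e.
have yN2 s : I s -> dot (x s - o) (N2 s) = focal_coef k tau s.
  move=> Is; have k0 := frenet_k_neq0 F Is.
  (* The derivative of dot y N1 is computed from its value - 1 / k and, below,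
     by the product rule, where it is tau (dot y N2). *)
  have d0 : is_derive s 1 (fun t => dot (x t - o) (N1 t))
      (derive1 k s / k s ^+ 2).
    apply: (is_derive_eq_in_open openI Is (f := fun t => - (k t)^-1)).
      by move=> t It; rewrite yN1.
    apply: is_derive_eq.
      by apply: is_deriveN; apply: is_deriveV => //;
        apply: derivable_is_derive1; exact: (frenet_k F).
    by rewrite /GRing.scale/= mulNr opprK mulrC.
  have := is_derive_unique (is_derive_dot (dy s Is) (frenet_N1 F Is)) d0.
  rewrite dotDr !dotZr perp// (frenet_TN1 F Is).
  rewrite mulr0 !add0r => e.
  by rewrite /focal_coef invfM mulrA -e mulrC mulKf// (frenet_tau_neq0 F Is).
move=> s Is; apply: (is_derive_eq_in_open openI Is yN2).
apply: (is_derive_eq (is_derive_dot (dy s Is) (frenet_N2 F Is))).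
by rewrite (frenet_TN2 F Is) dotZr yN1// add0r mulrNN.
Qed.

(** The center of the osculating sphere does not move. *)
Lemma exists_focal_center (R : realType) (I : set R) (x T N1 N2 : R -> 'rV[R]_3)
    (k tau : R -> R) :
  is_interval I -> frenet_curve I x T N1 N2 k tau ->
  (forall s, I s -> is_derive s 1 (focal_coef k tau) (tau s / k s)) ->
  exists o, forall s, I s -> dot (x s - o) (T s) = 0.
Proof.
move=> itvI F dfoc.
pose c t := x t + (k t)^-1 *: N1 t - focal_coef k tau t *: N2 t.
have dc s : I s -> is_derive s 1 c 0.
  move=> Is; have k0 := frenet_k_neq0 F Is; have t0 := frenet_tau_neq0 F Is.
  have dk := derivable_is_derive1 (frenet_k F Is).
  apply: (is_derive_eq (is_deriveB (is_deriveD (frenet_der F Is)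
    (is_derive_scale (is_deriveV k0 dk) (frenet_N1 F Is)))
    (is_derive_scale (dfoc s Is) (frenet_N2 F Is)))).
  by apply/rowP => i; rewrite !mxE /focal_coef /GRing.scale/=; field;
    rewrite k0 t0.
(* On an empty interval there is no point at which to take the center, and any
   origin will do. *)
have [[s0 Is0]|I0] := pselect (exists s, I s); last first.
  by exists 0 => s Is; case: I0; exists s.
exists (c s0) => s Is.
rewrite -(derive_eq0_cst_interval itvI dc Is Is0) /c.
have -> : x s - (x s + (k s)^-1 *: N1 s - focal_coef k tau s *: N2 s) =
    - (k s)^-1 *: N1 s + focal_coef k tau s *: N2 s.
  by apply/rowP => i; rewrite !mxE; ring.
by rewrite dotDl !dotZl !(dotC _ (T s)) (frenet_TN1 F Is)
  (frenet_TN2 F Is) !mulr0 addr0.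
Qed.

(** * The Frenet frame of a unit speed curve *)

Lemma is_derive_derive1n (R : realType) (n : nat) (I : set R)
    (x : R -> 'rV[R]_3) (k : nat) (s : R) :
  differentiable_times n I x -> (k < n)%N -> I s ->
  is_derive s 1 (derive1n k x) (derive1n k.+1 x s).
Proof. by move=> dx kn Is; apply: derivable_is_derive1; exact: dx. Qed.

Lemma is_derive_enorm (R : realType) (X : R -> 'rV[R]_3) (s : R)
    (dX : 'rV[R]_3) :
  0 < enorm (X s) -> is_derive s 1 X dX ->
  is_derive s 1 (fun t => enorm (X t)) (dot (X s) dX * (enorm (X s))^-1).
Proof.
move=> n0 Xs.
have d0 : 0 < dot (X s) (X s) by rewrite -enorm_sqr exprn_gt0.
apply: (is_derive_eq (is_derive1_comp (f := Num.sqrt) (is_derive1_sqrt d0)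
  (is_derive_dot Xs Xs))).
rewrite -[Num.sqrt _]/(enorm (X s)) (dotC dX).
by field; rewrite gt_eqF.
Qed.

Lemma is_derive_curvature (R : realType) (I : set R) (x : R -> 'rV[R]_3)
    (s : R) :
  differentiable_times 3 I x -> I s -> 0 < curvature x s ->
  is_derive s 1 (curvature x)
    (dot (derive1n 2 x s) (derive1n 3 x s) * (curvature x s)^-1).
Proof.
move=> dx Is k0.
exact: (is_derive_enorm k0 (is_derive_derive1n dx (isT : 2 < 3)%N Is)).
Qed.

Lemma is_derive_normal1 (R : realType) (I : set R) (x : R -> 'rV[R]_3) (s : R) :
  differentiable_times 3 I x -> I s -> 0 < curvature x s ->
  is_derive s 1 (normal1 x)
    ((- (curvature x s) ^- 2 * derive1 (curvature x) s) *: derive1n 2 x s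
     + (curvature x s)^-1 *: derive1n 3 x s).
Proof.
move=> dx Is k0; have dk := is_derive_curvature dx Is k0.
apply: is_derive_scale; last exact: is_derive_derive1n dx _ Is.
rewrite (is_derive_derive1 dk).
by apply: is_deriveV => //; rewrite gt_eqF.
Qed.

(** Only T' = k N1 is assumed; the other two equations follow.  Differentiating
    the constants dot N1 N1 and dot T N1 gives the components of N1' along N1
    and T, its component along N2 is tau by definition, and N2 is a product of
    the first two vectors of the frame. *)
Lemma frenet_equations (R : realType) (I : set R) (x T N1 : R -> 'rV[R]_3)
    (k : R -> R) :
  let N2 t := cross (T t) (N1 t) in
  let tau t := dot (derive1 N1 t) (N2 t) in
  open I ->
  (forall s, I s -> is_derive s 1 x (T s)) ->
  (forall s, I s -> is_derive s 1 T (k s *: N1 s)) ->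
  (forall s, I s -> derivable N1 s 1) ->
  (forall s, I s -> derivable k s 1) ->
  (forall s, I s -> dot (T s) (T s) = 1) ->
  (forall s, I s -> dot (N1 s) (N1 s) = 1) ->
  (forall s, I s -> k s != 0) -> (forall s, I s -> tau s != 0) ->
  frenet_curve I x T N1 N2 k tau.
Proof.
move=> N2 tau openI dx dT dN1 dk TT N1N1 k0 tau0.
have cst0 (f : R -> R) (c : R) s :
  (forall t, I t -> f t = c) -> I s -> is_derive s 1 f 0.
  move=> fc Is; apply: (is_derive_eq_in_open openI Is _ (is_derive_cst c s 1)).
  by move=> t It; rewrite fc.
have {}dN1 s : I s -> is_derive s 1 N1 (derive1 N1 s).
  by move=> Is; apply: derivable_is_derive1; exact: dN1.
have TN1 s : I s -> dot (T s) (N1 s) = 0.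
  move=> Is;
    have := is_derive_unique (is_derive_dot (dT s Is) (dT s Is))
      (cst0 _ _ s TT Is).
  rewrite dotZl dotZr (dotC (N1 s)) -mulr2n => /eqP.
  by rewrite mulrn_eq0/= mulf_eq0 (negPf (k0 s Is)) => /eqP.
have eN1 s : I s -> derive1 N1 s = - k s *: T s + tau s *: N2 s.
  move=> Is.
  have N1dN1 : dot (derive1 N1 s) (N1 s) = 0.
    have := is_derive_unique (is_derive_dot (dN1 s Is) (dN1 s Is))
      (cst0 _ _ s N1N1 Is).
    rewrite [X in _ + X]dotC -mulr2n => /eqP.
    by rewrite mulrn_eq0/= => /eqP.
  have TdN1 : dot (derive1 N1 s) (T s) = - k s.
    have := is_derive_unique (is_derive_dot (dT s Is) (dN1 s Is))
      (cst0 _ _ s TN1 Is).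
    rewrite dotZl N1N1// mulr1 addrC dotC => /eqP.
    by rewrite addr_eq0 => /eqP.
  have := gram_decomposition (T s) (N1 s) (derive1 N1 s).
  rewrite TT// N1N1// TN1// N1dN1 TdN1 -[dot _ (cross _ _)]/(tau s).
  by rewrite !(mulr0, mul0r, mulr1, subr0, expr0n, scale1r, scale0r, addr0).
split=> //.
- by move=> s Is; exact: is_derive_eq (dN1 s Is) (eN1 s Is).
- move=> s Is; apply: (is_derive_eq (is_derive_cross (dT s Is) (dN1 s Is))).
  rewrite eN1// crossZl crossuu scaler0 add0r crossDr !crossZr crossuu scaler0.
  by rewrite add0r cross_cross TN1// TT// scale0r scale1r sub0r scalerN scaleNr.
- by move=> s _; exact: dot_cross_l.
Qed.

Lemma unit_speed_frenet (R : realType) (I : set R) (x : R -> 'rV[R]_3) :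
  open I -> differentiable_times 3 I x -> unit_speed I x ->
  (forall s, I s -> 0 < curvature x s) ->
  (forall s, I s -> torsion x s <> 0) ->
  frenet_curve I x (tangent x) (normal1 x) (normal2 x) (curvature x)
    (torsion x).
Proof.
move=> openI dx unitx kpos tau0.
have k0 s : I s -> curvature x s != 0 by move=> Is; rewrite gt_eqF ?kpos.
apply: (@frenet_equations R I x (tangent x) (normal1 x) (curvature x) openI).
- by move=> s Is; exact: is_derive_derive1n dx (isT : 0 < 3)%N Is.
- move=> s Is; apply: (is_derive_eq (is_derive_derive1n dx (isT : 1 < 3)%N Is)).
  by rewrite scalerA (divff (k0 s Is)) scale1r.
- move=> s Is; exact: is_derive_derivable (is_derive_normal1 dx Is (kpos s Is)).
- move=> s Is;
  exact: is_derive_derivable (is_derive_curvature dx Is (kpos s Is)).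
- by move=> s Is; rewrite -enorm_sqr unitx// expr1n.
- move=> s Is; rewrite dotZl dotZr -enorm_sqr -[enorm _]/(curvature x s).
  by field; exact: k0.
- exact: k0.
- by move=> s Is; apply/eqP/tau0.
Qed.

(** The functions focal_coef is made of are only known through derivatives of
    other functions, so each of them is first replaced on I by its explicit
    formula: kappa1' involves the third derivative of x, and so does N1', hence
    kappa2.  Differentiating once more takes the fourth one. *)
Lemma derivable_focal_coef (R : realType) (I : set R) (x : R -> 'rV[R]_3)
    (s : R) :
  open I -> differentiable_times 4 I x ->
  (forall t, I t -> 0 < curvature x t) -> I s -> torsion x s <> 0 ->
  (forall t, I t -> derivable (normal2 x) t 1) ->
  derivable (focal_coef (curvature x) (torsion x)) s 1.
Proof.
move=> openI dx4 kpos Is tau0 dN2.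
have dx : differentiable_times 3 I x by move=> j j3; apply: dx4; exact: ltnW.
have dk t It := is_derive_curvature dx It (kpos t It).
have k0 : curvature x s != 0 by rewrite gt_eqF ?kpos.
have dx2 := is_derive_derive1n dx4 (isT : 2 < 4)%N Is.
have dx3 := is_derive_derive1n dx4 (isT : 3 < 4)%N Is.
have ddk := is_derive_derive1_in_open openI Is dk
  (is_derive_mul (is_derive_dot dx2 dx3) (is_deriveV k0 (dk s Is))).
have dks : is_derive s 1 (curvature x) (derive1 (curvature x) s).
  by apply: derivable_is_derive1; exact: is_derive_derivable (dk s Is).
have dk2 := is_derive_mul dks dks.
have k20 : curvature x s * curvature x s != 0 by rewrite mulf_neq0.
have ddN1 := is_derive_derive1_in_open openI Is
  (fun t It => is_derive_normal1 dx It (kpos t It))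
  (is_deriveD (is_derive_scale
     (is_derive_mul (is_deriveN
       (is_deriveV
         (f := fun t => curvature x t * curvature x t) k20 dk2)) ddk) dx2)
     (is_derive_scale (is_deriveV k0 dks) dx3)).
have dtau := is_derive_dot ddN1 (derivable_is_derive1 (dN2 s Is)).
have k2tau0 : curvature x s * curvature x s * torsion x s != 0.
  by rewrite mulf_neq0//; exact/eqP.
exact: (is_derive_derivable (is_derive_mul ddk (is_deriveV
  (f := fun t => curvature x t * curvature x t * torsion x t) k2tau0
  (is_derive_mul dk2 dtau)))).
Qed.

Theorem theorem3 (R : realType) (I : set R) (x : R -> 'rV[R]_3)
    (openI : open I) (intervalI : is_interval I)
    (diffx : differentiable_times 4 I x)
    (unitx : unit_speed I x)
    (curvature_gt0 : forall s, I s -> 0 < curvature x s)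
    (torsion_neq0 : forall s, I s -> torsion x s <> 0) :
  (exists o : 'rV[R]_3, T_constant_first_kind I (position_from o x))
  <->
  (forall s, I s ->
     torsion x s / curvature x s
     - derive1 (fun t => derive1 (curvature x) t
                         / (curvature x t ^+ 2 * torsion x t)) s = 0).
Proof.
have dx : differentiable_times 3 I x by move=> j j3; apply: diffx; exact: ltnW.
have F := unit_speed_frenet openI dx unitx curvature_gt0 torsion_neq0.
have tangent_o o s : I s -> tangent (position_from o x) s = tangent x s.
  move=> Is; have := is_deriveB (frenet_der F Is) (is_derive_cst o s 1).
  by rewrite subr0 => /is_derive_derive1.
have norm0 o s : I s -> enorm (tangential_part (position_from o x) s) = 0 <->
    dot (x s - o) (tangent x s) = 0.
  move=> Is;
    rewrite /enorm /tangential_part tangent_o// dotZl dotZr (frenet_TT F Is).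
  rewrite mulr1 -expr2 sqrtr_sqr /position_from.
  by split=> [/normr0_eq0|->]; rewrite ?normr0.
split=> [[ o [_ perp]] s Is|ode].
  have := is_derive_focal_coef openI F (fun t It => (norm0 o t It).1
    (perp t It)) Is.
  by move=> /is_derive_derive1 E; apply/eqP; rewrite subr_eq0 -E.
have dfoc s : I s -> is_derive s 1 (focal_coef (curvature x) (torsion x))
    (torsion x s / curvature x s).
  move=> Is; rewrite (subr0_eq (ode s Is)); apply: derivable_is_derive1.
  apply: (derivable_focal_coef openI diffx) => //; first exact: torsion_neq0.
  by move=> t It; apply: is_derive_derivable (frenet_N2 F It).
have [ o perp] := exists_focal_center intervalI F dfoc.
have perp0 s : I s -> enorm (tangential_part (position_from o x) s) = 0.
  by move=> Is; apply/norm0 => //; exact: perp.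
by exists o; split=> //; exists 0.
Qed.
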